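(* Consider the SWEMED1 system $\partial_t W+A(W)\partial_x W=S(W)$, with $A$ and $S$ as in the context, at the fully-settled water-at-rest manifold $\mathcal E_{wr}=\{W\in G:\ u_m=0,\ \alpha_1=0,\ c_m=0\}$. Then, at every $W\in\mathcal E_{wr}$, Yong's condition (I) holds, whereas Yong's conditions (II) and (III) fail. That is: there exist invertible $P(W)$ and $\widehat T(W)$ as required in (I); there is no symmetric positive definite matrix $A_0(W)$ satisfying (II); and consequently there is none satisfying (III), in which $A_0(W)$ is required to be a symmetrizer as in (II).
   Context: The state is $W=(h,hu_m,h\alpha_1,hc_m,h_b)^T\in\mathbb R^5$, where $h$ is the water height, $u_m$ the mean velocity, $\alpha_1$ the first velocity-moment coefficient, $c_m$ the depth-averaged suspended sediment concentration and $h_b$ the bed elevation. The admissible set is $G=\{W: h>0,\ 0\le c_m\le 1\}$ (the formulas for $A$ and $S$ also make sense for $W$ in a neighbourhood of $G$, so the Jacobian $S_W=\partial S/\partial W$ is defined on $G$). The bottom velocity is $u_b=u_m+\alpha_1$ and the mixture density is $\rho=\rho_w+c_m(\rho_s-\rho_w)$. Transport matrix: $$A(W)=\begin{pmatrix}0&1&0&0&0\\ gh-u_m^2-\frac{\alpha_1^2}{3}-\frac{ghc_m(\rho_s-\rho_w)}{2\rho}&2u_m&\frac{2\alpha_1}{3}&\frac{gh(\rho_s-\rho_w)}{2\rho}&gh\\ -2\alpha_1u_m-\frac{ghc_m(\rho_s-\rho_w)}{2\rho}&2\alpha_1&u_m&\frac{gh(\rho_s-\rho_w)}{2\rho}&0\\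 -c_mu_m&c_m&0&u_m&0\\ \delta_h&\delta_q&\delta_q&\delta_c&0\end{pmatrix},$$ $$\delta_q=\frac{24Q}{1-\psi}\operatorname{sgn}(u_b)\frac{\rho\epsilon}{g(\rho_s-\rho_w)d_s}(\theta-\theta_c)_+^{1/2}\frac{u_b}{h},\quad \delta_h=-u_b\left(1+\frac{c_m(\rho_s-\rho_w)}{2\rho}\right)\delta_q,\quad \delta_c=u_b\frac{\rho_s-\rho_w}{2\rho}\delta_q,$$ where $\theta=\frac{\rho\epsilon u_b^2}{g(\rho_s-\rho_w)d_s}$ is the Shields parameter, $(\cdot)_+$ the positive part, $\theta_c\ge0$ the critical Shields parameter, and $Q>0$ a constant. Source term: $$S(W)=\begin{pmatrix}\frac{E-D}{1-\psi}\\ -\epsilon|u_b|u_b+\frac{E-D}{1-\psi}u_b\\ -3\left(\epsilon|u_b|u_b+4\frac{\nu}{h}\alpha_1\right)+2\frac{E-D}{1-\psi}\alpha_1\\ E-D\\ \frac{D-E}{1-\psi}\end{pmatrix},\qquad E=\omega_0(1-\psi)E_s,\quad D=\omega_0S_bc_m,$$ $$E_s=\frac{1.3\times10^{-7}\mathcal Z^5}{1+4.3\times10^{-7}\mathcal Z^5},\qquad \mathcal Z=\frac{\gamma_1\sqrt{c_D}\,|u_b|}{\omega_0}\mathcal R_p^{\gamma_2}.$$ Constants: $g,\epsilon,\nu,d_s,\omega_0,S_b,c_D,\mathcal R_p>0$, $\rho_s>\rho_w>0$, $\psi\in[0,1)$; $(\gamma_1,\gamma_2)=(1,0.6)$ if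 $\mathcal R_p>2.36$ and $(0.586,1.23)$ if $\mathcal R_p\le2.36$. Yong's structural stability conditions at an equilibrium state $W$ (with $S_W$ the source Jacobian): (I) (block condition) There are an invertible matrix $P(W)$, an integer $r$ and an invertible $r\times r$ matrix $\widehat T(W)$ with $P(W)S_W(W)P(W)^{-1}=\begin{pmatrix}0&0\\0&\widehat T(W)\end{pmatrix}$. (II) (transport symmetrization) There is a symmetric positive definite $A_0(W)$ with $A_0(W)A(W)=A(W)^TA_0(W)$. (III) (dissipation compatibility) With $A_0(W)$ as in (II) and $P(W)$, $r$ as in (I), $A_0(W)S_W(W)+S_W(W)^TA_0(W)\preceq -P(W)^T\begin{pmatrix}0&0\\0&I_r\end{pmatrix}P(W)$, where $\preceq$ is the Loewner order on symmetric matrices. *)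

(* Defs.v *)
From HB Require Import structures.
From mathcomp Require Import all_boot all_order all_algebra.
From mathcomp Require Import all_classical all_reals all_analysis.

Set Implicit Arguments.
Unset Strict Implicit.
Unset Printing Implicit Defensive.

Import Order.TTheory GRing.Theory Num.Theory.
Import numFieldNormedType.Exports.

Local Open Scope ring_scope.

Definition rows_mx (R : realType) (m n : nat) (rows : seq (seq R)) :
    'M[R]_(m, n) :=
  \matrix_(i < m, j < n) nth 0 (nth [::] rows i) j.

Definition seq_rv (R : realType) (n : nat) (s : seq R) : 'rV[R]_n :=
  \row_(j < n) nth 0 s j.

Definition posdef (R : realType) (n : nat) (M : 'M[R]_n) : Prop :=
  M^T = M /\ forall v : 'rV[R]_n, v != 0 -> 0 < (v *m M *m v^T) 0 0.

Definition possemidef (R : realType) (n : nat) (M : 'M[R]_n) : Prop :=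
  M^T = M /\ forall v : 'rV[R]_n, 0 <= (v *m M *m v^T) 0 0.

Definition loewner_le (R : realType) (n : nat) (X Y : 'M[R]_n) : Prop :=
  possemidef (Y - X).

(* The n x n matrix diag(0, T) with T of size r; the cast along
   k + r = n only identifies the index types. *)
Definition lower_block (R : realType) (n k r : nat) (e : (k + r)%N = n)
    (T : 'M[R]_r) : 'M[R]_n :=
  castmx (e, e) (block_mx 0 0 0 T).

(* In Yong's conditions below, A is the value of the transport matrix and B the
   value of the source Jacobian at the state under consideration. *)

Definition block_reduction (R : realType) (n k r : nat) (e : (k + r)%N = n)
    (B P : 'M[R]_n) (T : 'M[R]_r) : Prop :=
  [/\ P \in unitmx, T \in unitmx & P *m B *m invmx P = lower_block e T].

Definition symmetrizer (R : realType) (n : nat) (A A0 : 'M[R]_n) : Prop :=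
  posdef A0 /\ A0 *m A = A^T *m A0.

Definition yong_I (R : realType) (n : nat) (B : 'M[R]_n) : Prop :=
  exists (k r : nat) (e : (k + r)%N = n) (P : 'M[R]_n) (T : 'M[R]_r),
    block_reduction e B P T.

Definition yong_II (R : realType) (n : nat) (A : 'M[R]_n) : Prop :=
  exists A0 : 'M[R]_n, symmetrizer A A0.

(* The symmetrizer is existentially quantified here together with P and r, so
   the negation of yong_III excludes every choice of A0, P, r. *)
Definition yong_III (R : realType) (n : nat) (A B : 'M[R]_n) : Prop :=
  exists A0 : 'M[R]_n, symmetrizer A A0 /\
  exists (k r : nat) (e : (k + r)%N = n) (P : 'M[R]_n) (T : 'M[R]_r),
    block_reduction e B P T /\
    loewner_le (A0 *m B + B^T *m A0)
               (- (P^T *m lower_block e (1%:M : 'M[R]_r) *m P)).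

Record params (R : realType) := Params {
  grav : R;
  eps : R;     (* friction coefficient *)
  nu : R;
  ds : R;      (* sediment diameter *)
  omega0 : R;  (* settling velocity *)
  Sb : R;
  cD : R;
  Rp : R;      (* particle Reynolds number *)
  rhos : R;
  rhow : R;
  psi : R;     (* bed porosity *)
  thetac : R;  (* critical Shields parameter *)
  Q : R
}.

Definition valid_params (R : realType) (p : params R) : Prop :=
  [/\ [/\ 0 < grav p, 0 < eps p, 0 < nu p & 0 < ds p],
      [/\ 0 < omega0 p, 0 < Sb p, 0 < cD p & 0 < Rp p],
      0 < rhow p < rhos p,
      0 <= psi p < 1 &
      0 <= thetac p /\ 0 < Q p].

(* States W = (h, h u_m, h alpha_1, h c_m, h_b) are row vectors; the
   primitive quantities are recovered by dividing by h. *)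
Definition height (R : realType) (W : 'rV[R]_5) : R := W 0 (inord 0).
Definition um (R : realType) (W : 'rV[R]_5) : R := W 0 (inord 1) / height W.
Definition alpha1 (R : realType) (W : 'rV[R]_5) : R :=
  W 0 (inord 2) / height W.
Definition cm (R : realType) (W : 'rV[R]_5) : R := W 0 (inord 3) / height W.

Definition admissible (R : realType) (W : 'rV[R]_5) : Prop :=
  0 < height W /\ 0 <= cm W <= 1.

Definition water_at_rest (R : realType) (W : 'rV[R]_5) : Prop :=
  admissible W /\ [/\ um W = 0, alpha1 W = 0 & cm W = 0].

Definition ub (R : realType) (W : 'rV[R]_5) : R := um W + alpha1 W.

Definition rho (R : realType) (p : params R) (W : 'rV[R]_5) : R :=
  rhow p + cm W * (rhos p - rhow p).

Definition shields (R : realType) (p : params R) (W : 'rV[R]_5) : R :=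
  rho p W * eps p * ub W ^+ 2 / (grav p * (rhos p - rhow p) * ds p).

(* Num.max 0 x is the positive part of x. *)
Definition delta_q (R : realType) (p : params R) (W : 'rV[R]_5) : R :=
  24 * Q p / (1 - psi p) * Num.sg (ub W)
  * (rho p W * eps p / (grav p * (rhos p - rhow p) * ds p))
  * Num.sqrt (Num.max 0 (shields p W - thetac p)) * (ub W / height W).

Definition delta_h (R : realType) (p : params R) (W : 'rV[R]_5) : R :=
  - ub W * (1 + cm W * (rhos p - rhow p) / (2 * rho p W)) * delta_q p W.

Definition delta_c (R : realType) (p : params R) (W : 'rV[R]_5) : R :=
  ub W * ((rhos p - rhow p) / (2 * rho p W)) * delta_q p W.

Definition transport (R : realType) (p : params R) (W : 'rV[R]_5) : 'M[R]_5 :=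
  let h := height W in let u := um W in let a := alpha1 W in
  let c := cm W in let g := grav p in
  let drho := rhos p - rhow p in
  rows_mx 5 5
    [:: [:: 0; 1; 0; 0; 0];
        [:: g * h - u ^+ 2 - a ^+ 2 / 3 - g * h * c * drho / (2 * rho p W);
            2 * u; 2 * a / 3; g * h * drho / (2 * rho p W); g * h];
        [:: - (2 * a * u) - g * h * c * drho / (2 * rho p W);
            2 * a; u; g * h * drho / (2 * rho p W); 0];
        [:: - (c * u); c; 0; u; 0];
        [:: delta_h p W; delta_q p W; delta_q p W; delta_c p W; 0]].

Definition gamma1 (R : realType) (p : params R) : R :=
  if 236 / 100 < Rp p then 1 else 586 / 1000.

Definition gamma2 (R : realType) (p : params R) : R :=
  if 236 / 100 < Rp p then 6 / 10 else 123 / 100.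

Definition Zent (R : realType) (p : params R) (W : 'rV[R]_5) : R :=
  gamma1 p * Num.sqrt (cD p) * `|ub W| / omega0 p * powR (Rp p) (gamma2 p).

Definition Es (R : realType) (p : params R) (W : 'rV[R]_5) : R :=
  (13 / 10 * 10 ^- 7 * Zent p W ^+ 5)
  / (1 + 43 / 10 * 10 ^- 7 * Zent p W ^+ 5).

Definition entrainment (R : realType) (p : params R) (W : 'rV[R]_5) : R :=
  omega0 p * (1 - psi p) * Es p W.

Definition deposition (R : realType) (p : params R) (W : 'rV[R]_5) : R :=
  omega0 p * Sb p * cm W.

Definition source (R : realType) (p : params R) (W : 'rV[R]_5) : 'rV[R]_5 :=
  let h := height W in let u := ub W in let a := alpha1 W in
  let E := entrainment p W in let D := deposition p W in
  seq_rv 5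
    [:: (E - D) / (1 - psi p);
        - (eps p * `|u| * u) + (E - D) / (1 - psi p) * u;
        - (3 * (eps p * `|u| * u + 4 * (nu p / h) * a))
          + 2 * ((E - D) / (1 - psi p)) * a;
        E - D;
        (D - E) / (1 - psi p)].

(* [jacobian] acts on row vectors, with entry (i, j) equal to
   d S_j / d W_i; the transpose gives the usual (dS/dW)_(i, j) = dS_i/dW_j. *)
Definition source_jacobian (R : realType) (p : params R) (W : 'rV[R]_5) :
    'M[R]_5 :=
  (jacobian (source p) W)^T.

(* Main.v *)
Require Import Defs.
From mathcomp Require Import all_boot all_order all_algebra.
From mathcomp Require Import all_classical all_reals all_analysis.
From mathcomp Require Import ring.

(** Failure of (II), hence of (III): a symmetrizer [A0] of [A] makes [A]
    self-adjoint for the inner product it defines, so [A] is diagonalizable and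
    [A (A w) = 0] forces [A w = 0].  At rest [transport] has a Jordan block of
    size two at the eigenvalue 0: the state perturbation that adds sediment and
    removes just enough water to keep the total pressure force in the momentum
    equation balanced is sent to the first moment direction, which is itself in
    the kernel ([not_yong_II_jordan], [not_yong_II_rest]).

    Validity of (I): every term of the source is a product of a factor that
    vanishes at rest and a continuous one, so the Leibniz rule
    [is_diff_mul_vanish] asks for differentiability of the vanishing factor
    alone.  This deals at once with the divisions by the height and with the
    nonsmooth powers of [`|ub W|]: quadratic friction and entrainment have zero
    derivative, and only the viscous decay of [alpha1] and the settling of [cm]
    contribute to the Jacobian ([source_jacobian_rest]).  That matrix has
    rank two and two negative eigenvalues, and is diagonalizable: the
    height and the bed elevation, which settling drives, each combine with the
    sediment mass into a conserved quantity ([yong_I_rest_jacobian]). *)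

Set Implicit Arguments.
Unset Strict Implicit.
Unset Printing Implicit Defensive.

Import Order.TTheory GRing.Theory Num.Theory.
Import numFieldNormedType.Exports.

Local Open Scope ring_scope.

(** * Differentiating products whose factors vanish *)

(** Near [x] the factor [f] is bounded by a multiple of the distance to [x],
    while [g] tends to 0, so that the product is negligible at first order. *)
Lemma is_diff_mul_vanish2 (R : realType) (V : normedModType R)
    (f g df : V -> R) (x : V) :
  is_diff x f df -> f x = 0 -> {for x, continuous g} -> g x = 0 ->
  is_diff x (fun y => f y * g y) (fun=> 0).
Proof.
move=> /(@ex_diff _ _ _ _ _ _ _) dfx fx gc gx.
pose Z : {linear V -> R} := \0.
have Zc : continuous (Z : V -> R) by exact: cst_continuous.
suff fgo : (fun y => f y * g y) \o shift x
    = cst (f x * g x) + (Z : V -> R) +o_ 0 id.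
  have dZ : 'd (fun y => f y * g y) x = Z :> (V -> R) by exact: diff_unique.
  by apply: DiffDef; [apply/diff_locallyP; rewrite dZ | rewrite dZ].
apply/eqaddoP => _ /posnumP[e].
have [k k0 kP] := linear_lipschitz (diff_continuous dfx).
have k1 : 0 < 1 + k by rewrite addr_gt0.
have fo : \forall h \near (0 : V), `|f (h + x)| <= (1 + k) * `|h|.
  have /diff_locally /eqaddoP /(_ 1 ltr01) := dfx.
  apply: filterS => h; rewrite !fctE /= fx add0r mul1r => fh.
  rewrite -[f _](subrK ('d f x h)) (le_trans (ler_normD _ _))// mulrDl mul1r.
  by rewrite lerD.
have go : \forall h \near (0 : V), `|g (h + x)| <= e%:num / (1 + k).
  have ek : 0 < e%:num / (1 + k) by rewrite divr_gt0.
  have /(cvgrPdist_le (FF := nbhs_filter x)) /(_ _ ek) := gc.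
  rewrite -{1}[x]add0r => /nbhsDl.
  by apply: filterS => h /=; rewrite gx sub0r normrN.
near=> h; rewrite !fctE /= fx mul0r addr0 subr0 normrM.
apply: (@le_trans _ _ ((1 + k) * `|h| * (e%:num / (1 + k)))).
  by apply: ler_pM => //; near: h.
by rewrite mulrC mulrA divfK ?gt_eqF.
Unshelve. all: by end_near. Qed.

(** Leibniz rule for a merely continuous cofactor: replacing [g] by its value at
    [x] changes the product only by [f * (g - g x)], whose two factors vanish
    at [x]. *)
Lemma is_diff_mul_vanish (R : realType) (V : normedModType R)
    (f g df : V -> R) (x : V) :
  is_diff x f df -> f x = 0 -> {for x, continuous g} ->
  is_diff x (fun y => f y * g y) (fun v => df v * g x).
Proof.
move=> dfx fx gc.
have gc0 : {for x, continuous (fun y => g y - g x)}.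
  by apply: cvgB => //; exact: cvg_cst.
have d0 := is_diff_mul_vanish2 dfx fx gc0 (subrr _).
have d1 := is_diffD d0 (is_diffZ (g x) dfx).
rewrite (_ : (fun y => f y * g y)
  = (fun y => f y * (g y - g x)) + g x *: f); last first.
  by apply/funext => y; rewrite !fctE /GRing.scale /=; ring.
apply: is_diff_eq d1 _.
by apply/funext => y; rewrite !fctE /GRing.scale /= add0r mulrC.
Qed.

Lemma is_diff_coord (R : realType) m n (M : 'M[R]_(m, n)) i j :
  is_diff M (fun N : 'M[R]_(m, n) => N i j : R) (fun N => N i j).
Proof.
apply: DiffDef; first exact: differentiable_coord.
have @f : {linear 'M[R]_(m, n) -> R}.
  by exists (fun N : 'M[R]_(_, _) => N i j); do 2![eexists]; do ?[constructor];
     rewrite ?mxE// => ? *; rewrite ?mxE//; move=> ?; rewrite !mxE.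
by rewrite (_ : (fun _ => _) = f) // diff_lin //; exact: coord_continuous.
Qed.

(** Reduction to scalar functions: [F] is the sum of its coordinates times the
    basis vectors, hence differentiable as soon as they are, and its
    differential can then be read off coordinatewise. *)
Lemma jacobian_row (R : realType) (m n : nat) (F : 'rV[R]_m -> 'rV[R]_n)
    (dF : 'I_n -> 'rV[R]_m -> R) (x : 'rV[R]_m) :
  (forall j, is_diff x (fun y => F y 0 j) (dF j)) ->
  jacobian F x = \matrix_(i, j) dF j (delta_mx 0 i).
Proof.
move=> dFx.
have Fx : differentiable F x.
  rewrite (_ : F = \sum_(j < n) (fun y => F y 0 j *: delta_mx 0 j)); last first.
    by apply/funext => y; rewrite fct_sumE; exact: row_sum_delta.
  apply: differentiable_sum => j.
  by apply: (@differentiableZl _ _ _ (fun y => F y 0 j)); exact: ex_diff.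
apply/matrixP => i j; rewrite !mxE.
rewrite -(@diff_val _ _ _ _ _ _ _ (dFx j)).
rewrite (@diff_comp _ _ _ _ F (fun N : 'rV[R]_n => N 0 j)) //=.
- by rewrite (@diff_val _ _ _ _ _ _ _ (is_diff_coord (F x) 0 j)).
- exact: differentiable_coord.
Qed.

(** * The source Jacobian at rest *)

(** [a] is the viscous decay rate of the first moment, [d] the settling rate of
    the sediment, and [s] the volume of bed formed by a unit volume of settled
    grains. *)
Definition rest_jacobian (R : realType) (a d s : R) : 'M[R]_5 :=
  rows_mx 5 5
    [:: [:: 0; 0; 0; - (s * d); 0];
        [:: 0; 0; 0; 0; 0];
        [:: 0; 0; - a; 0; 0];
        [:: 0; 0; 0; - d; 0];
        [:: 0; 0; 0; s * d; 0]].

Section WaterAtRest.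
Context (R : realType) (p : params R) (W : 'rV[R]_5).
Hypothesis hW : water_at_rest W.

Local Notation h0 := (height W).

Let h0_gt0 : 0 < h0. Proof. by case: hW => -[]. Qed.

Let umW : um W = 0. Proof. by case: hW => _ []. Qed.
Let alpha1W : alpha1 W = 0. Proof. by case: hW => _ []. Qed.
Let cmW : cm W = 0. Proof. by case: hW => _ []. Qed.
Let ubW : ub W = 0. Proof. by rewrite /ub umW alpha1W addr0. Qed.

Lemma continuous_height_inv :
  {for W, continuous (fun V : 'rV[R]_5 => (height V)^-1)}.
Proof.
apply: differentiable_continuous;
  apply: differentiableV; last by rewrite gt_eqF.
exact: differentiable_coord.
Qed.

Lemma is_diff_primitive (i : 'I_5) : W 0 i / h0 = 0 ->
  is_diff W (fun V : 'rV[R]_5 => V 0 i / height V) (fun v => v 0 i / h0).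
Proof.
move=> /eqP; rewrite mulf_eq0 invr_eq0 (gt_eqF h0_gt0) orbF => /eqP Wi.
exact: is_diff_mul_vanish (is_diff_coord W 0 i) Wi continuous_height_inv.
Qed.

Lemma is_diff_alpha1 : is_diff W (@alpha1 R) (fun v => v 0 (inord 2) / h0).
Proof. exact: is_diff_primitive alpha1W. Qed.

Lemma is_diff_cm : is_diff W (@cm R) (fun v => v 0 (inord 3) / h0).
Proof. exact: is_diff_primitive cmW. Qed.

Lemma is_diff_ub : is_diff W (@ub R)
  (fun v => v 0 (inord 1) / h0 + v 0 (inord 2) / h0).
Proof. exact: is_diffD (is_diff_primitive umW) is_diff_alpha1. Qed.

Let ub_cont : {for W, continuous (@ub R)}.
Proof.
exact: differentiable_continuous (@ex_diff _ _ _ _ _ _ _ is_diff_ub).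
Qed.

Lemma is_diff_drag : is_diff W (fun V : 'rV[R]_5 => `|ub V| * ub V) (fun=> 0).
Proof.
rewrite (_ : (fun _ => _) = (fun V : 'rV[R]_5 => ub V * `|ub V|)); last first.
  by apply/funext => V; rewrite mulrC.
apply: (is_diff_mul_vanish2 is_diff_ub) => //.
  exact: continuous_comp ub_cont (@norm_continuous _ _ _).
by rewrite ubW normr0.
Qed.

(** [Zent], a multiple of [`|ub V|], has a corner at rest.  Its fifth power is
    smoother: up to a constant it is the drag [`|ub V| * ub V] times
    [(`|ub V| * ub V) * `|ub V|], and both factors vanish at rest. *)
Lemma is_diff_Zent5 : is_diff W (fun V => Zent p V ^+ 5) (fun=> 0).
Proof.
pose k : R :=
  (gamma1 p * Num.sqrt (cD p) / omega0 p * powR (Rp p) (gamma2 p)) ^+ 5.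
rewrite (_ : (fun _ => _) = (fun V : 'rV[R]_5 =>
   (`|ub V| * ub V) * (k * (`|ub V| * ub V) * `|ub V|))); last first.
  apply/funext => V; rewrite /Zent /k.
  have e : ub V * ub V = `|ub V| * `|ub V|.
    by rewrite -!expr2 real_normK ?num_real.
  transitivity (k * ((`|ub V| * `|ub V|) * (ub V * ub V) * `|ub V|)).
    by rewrite e /k; ring.
  by rewrite /k; ring.
apply: (is_diff_mul_vanish2 is_diff_drag).
- by rewrite ubW mulr0.
- apply: continuousM;
    last exact: continuous_comp ub_cont (@norm_continuous _ _ _).
  apply: continuousM; first exact: cst_continuous.
  exact: differentiable_continuous (@ex_diff _ _ _ _ _ _ _ is_diff_drag).
- by rewrite ubW normr0 mulr0.
Qed.

Let Zent5W : Zent p W ^+ 5 = 0.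
Proof. by rewrite /Zent ubW normr0 mulr0 !mul0r expr0n. Qed.

Lemma is_diff_Es : is_diff W (Es p) (fun=> 0).
Proof.
have dn := is_diffZ (13 / 10 * 10 ^- 7) is_diff_Zent5.
have dd := is_diffD (is_diff_cst (1 : R : normedModType R) W)
  (is_diffZ (43 / 10 * 10 ^- 7) is_diff_Zent5).
apply: is_diff_eq (is_diff_mul_vanish
  (g := fun V => (1 + 43 / 10 * 10 ^- 7 * Zent p V ^+ 5)^-1) dn _ _) _.
- by rewrite !fctE Zent5W scaler0.
- apply: differentiable_continuous; apply: differentiableV.
    exact: (@ex_diff _ _ _ _ _ _ _ dd).
  by rewrite Zent5W mulr0 addr0 oner_eq0.
- by apply/funext => v; rewrite !fctE scaler0 mul0r.
Qed.

Lemma is_diff_exchange :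
  is_diff W (fun V => entrainment p V - deposition p V)
    (fun v => - (omega0 p * Sb p * (v 0 (inord 3) / h0))).
Proof.
have dE := is_diffZ (omega0 p * (1 - psi p)) is_diff_Es.
have dD := is_diffZ (omega0 p * Sb p) is_diff_cm.
apply: is_diff_eq (is_diffB dE dD) _.
by apply/funext => v; rewrite !fctE scaler0 sub0r.
Qed.

Let exchangeW : entrainment p W - deposition p W = 0.
Proof.
by rewrite /entrainment /deposition /Es Zent5W cmW !(mulr0, mul0r) subrr.
Qed.

Let exchange_mul (g : 'rV[R]_5 -> R) : {for W, continuous g} -> g W = 0 ->
  is_diff W (fun V => (entrainment p V - deposition p V) * g V) (fun=> 0).
Proof. exact: is_diff_mul_vanish2 is_diff_exchange exchangeW. Qed.

Lemma source_jacobian_rest :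
  source_jacobian p W = rest_jacobian (12 * nu p / h0 ^+ 2)
    (omega0 p * Sb p / h0) (1 - psi p)^-1.
Proof.
pose a := 12 * nu p / h0 ^+ 2.
pose d := omega0 p * Sb p / h0.
pose s := (1 - psi p)^-1.
pose dF (j : 'I_5) (v : 'rV[R]_5) : R :=
  nth 0 [:: - (s * d * v 0 (inord 3)); 0; - (a * v 0 (inord 2));
            - (d * v 0 (inord 3)); s * d * v 0 (inord 3)] j.
have dX := is_diff_exchange.
have dsX := is_diffZ s dX.
have dS0 : is_diff W (fun V => source p V 0 (inord 0)) (dF (inord 0)).
  rewrite (_ : (fun _ => _) =
      s *: (fun V => entrainment p V - deposition p V)); last first.
    by apply/funext => V; rewrite !mxE inordK //= mulrC.
  apply: is_diff_eq dsX _; apply/funext => v.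
  by rewrite !fctE /dF inordK //= /GRing.scale /= /d; ring.
have dS1 : is_diff W (fun V => source p V 0 (inord 1)) (dF (inord 1)).
  have dXu : is_diff W
      (fun V => (entrainment p V - deposition p V) * ub V) (fun=> 0).
    exact: exchange_mul.
  rewrite (_ : (fun _ => _) =
     (- eps p) *: (fun V : 'rV[R]_5 => `|ub V| * ub V)
      + s *: (fun V => (entrainment p V - deposition p V) * ub V)); last first.
    by apply/funext => V;
      rewrite !mxE inordK //= !fctE /GRing.scale /= /s; ring.
  apply: is_diff_eq
    (is_diffD (is_diffZ (- eps p) is_diff_drag) (is_diffZ s dXu)) _.
  by apply/funext => v; rewrite !fctE /dF inordK //= !scaler0 addr0.
have dS2 : is_diff W (fun V => source p V 0 (inord 2)) (dF (inord 2)).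
  have dXa : is_diff W
      (fun V => (entrainment p V - deposition p V) * alpha1 V) (fun=> 0).
    apply: exchange_mul => //.
    exact: differentiable_continuous (@ex_diff _ _ _ _ _ _ _ is_diff_alpha1).
  have dah := is_diff_mul_vanish is_diff_alpha1 alpha1W continuous_height_inv.
  rewrite (_ : (fun _ => _) =
     (- (3 * eps p)) *: (fun V : 'rV[R]_5 => `|ub V| * ub V)
      + (- (12 * nu p)) *: (fun V : 'rV[R]_5 => alpha1 V * (height V)^-1)
      + (2 * s) *: (fun V => (entrainment p V - deposition p V) * alpha1 V));
    last first.
    by apply/funext => V;
      rewrite !mxE inordK //= !fctE /GRing.scale /= /s; ring.
  apply: is_diff_eq (is_diffD (is_diffD (is_diffZ (- (3 * eps p)) is_diff_drag)
     (is_diffZ (- (12 * nu p)) dah)) (is_diffZ (2 * s) dXa)) _.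
  apply/funext => v; rewrite !fctE /dF inordK //= !scaler0 addr0 add0r.
  by rewrite /GRing.scale /= /a expr2 invfM; ring.
have dS3 : is_diff W (fun V => source p V 0 (inord 3)) (dF (inord 3)).
  rewrite (_ : (fun _ => _) = (fun V => entrainment p V - deposition p V));
    last first.
    by apply/funext => V; rewrite !mxE inordK.
  apply: is_diff_eq dX _; apply/funext => v.
  by rewrite /dF inordK //= /d; ring.
have dS4 : is_diff W (fun V => source p V 0 (inord 4)) (dF (inord 4)).
  rewrite (_ : (fun _ => _) =
      - (s *: (fun V => entrainment p V - deposition p V))); last first.
    by apply/funext => V;
      rewrite !mxE inordK //= !fctE /GRing.scale /= /s; ring.
  apply: is_diff_eq (is_diffN dsX) _; apply/funext => v.
  by rewrite !fctE /dF inordK //= /GRing.scale /= /d; ring.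
have dSj j : is_diff W (fun V => source p V 0 j) (dF j).
  by rewrite -(inord_val j); case: j => -[|[|[|[|[|//]]]]].
rewrite /source_jacobian (jacobian_row dSj).
rewrite -/a -/d -/s; apply/matrixP => i j; rewrite !mxE /dF.
case: i => -[|[|[|[|[|//]]]]] Hi; case: j => -[|[|[|[|[|//]]]]] Hj;
  rewrite /= ?mxE -?(inj_eq val_inj) /= ?inordK //= ?(mulr0, mulr1, oppr0) //.
Qed.

End WaterAtRest.

(** * Yong's conditions at rest *)

Lemma yong_I_rest_jacobian (R : realType) (a d s : R) : a != 0 -> d != 0 ->
  yong_I (rest_jacobian a d s).
Proof.
move=> a0 d0.
(* The rows of P are left eigenvectors: the first three are the
   combinations of the state that the linearized source conserves, the last
   two the moment and the sediment mass, which decay at rates a and d. *)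
pose P : 'M[R]_5 := rows_mx 5 5
  [:: [:: 1; 0; 0; - s; 0]; [:: 0; 1; 0; 0; 0]; [:: 0; 0; 0; s; 1];
      [:: 0; 0; 1; 0; 0]; [:: 0; 0; 0; 1; 0]].
pose P' : 'M[R]_5 := rows_mx 5 5
  [:: [:: 1; 0; 0; 0; s]; [:: 0; 1; 0; 0; 0]; [:: 0; 0; 0; 1; 0];
      [:: 0; 0; 0; 0; 1]; [:: 0; 0; 1; 0; - s]].
pose T : 'M[R]_2 := rows_mx 2 2 [:: [:: - a; 0]; [:: 0; - d]].
pose T' : 'M[R]_2 := rows_mx 2 2 [:: [:: - a^-1; 0]; [:: 0; - d^-1]].
have PU : P \in unitmx.
  have /mulmx1_unit[] // : P *m P' = 1%:M.
  apply/matrixP => -[[|[|[|[|[|//]]]]] Hi] -[[|[|[|[|[|//]]]]] Hj];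
    rewrite !mxE !big_ord_recl big_ord0 !mxE /=; ring.
have TU : T \in unitmx.
  have /mulmx1_unit[] // : T *m T' = 1%:M.
  apply/matrixP => -[[|[|//]] Hi] -[[|[|//]] Hj];
    rewrite !mxE !big_ord_recl big_ord0 !mxE /=; field => //.
exists 3%N, 2%N, erefl, P, T; split => //.
apply: (canLR (mulmxK PU)).
have -> : lower_block (erefl : (3 + 2)%N = 5%N) T = rows_mx 5 5
  [:: [:: 0; 0; 0; 0; 0]; [:: 0; 0; 0; 0; 0]; [:: 0; 0; 0; 0; 0];
      [:: 0; 0; 0; - a; 0]; [:: 0; 0; 0; 0; - d]].
  rewrite /lower_block castmx_id; apply/(@matrixP _ (3 + 2) (3 + 2)) => i j.
  case: (split_ordP i) => i' ->; case: (split_ordP j) => j' ->;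
    rewrite ?(block_mxEul, block_mxEur, block_mxEdl, block_mxEdr) !mxE;
    case: i' => -[|[|[|//]]] Hi //; by case: j' => -[|[|[|//]]] Hj.
apply/matrixP => -[[|[|[|[|[|//]]]]] Hi] -[[|[|[|[|[|//]]]]] Hj];
    rewrite !mxE !big_ord_recl !big_ord0 !mxE /=; ring.
Qed.

(** A symmetrizer [A0] gives [(A w)^T A0 (A w) = w^T A0 A (A w) = 0], against
    positive definiteness: [A] cannot have a nontrivial Jordan block at 0. *)
Lemma not_yong_II_jordan (R : realType) n (A : 'M[R]_n) (w : 'cV[R]_n) :
  A *m (A *m w) = 0 -> A *m w != 0 -> ~ yong_II A.
Proof.
move=> AAw Aw [A0 [[_ A0pos] A0A]].
have := A0pos (A *m w)^T; rewrite trmx_eq0 => /(_ Aw).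
rewrite trmxK trmx_mul -(mulmxA _ A^T) -A0A -!mulmxA AAw !mulmx0 mxE.
by rewrite ltxx.
Qed.

Lemma yong_III_II (R : realType) n (A B : 'M[R]_n) : yong_III A B -> yong_II A.
Proof. by case=> A0 [sA0 _]; exists A0. Qed.

Lemma not_yong_II_rest (R : realType) (p : params R) (W : 'rV[R]_5) :
  valid_params p -> water_at_rest W -> ~ yong_II (transport p W).
Proof.
move=> [[g0 _ _ _] _ /andP[rw0 rws] _ _] [[hW _] [uW aW cW]].
pose gh := grav p * height W.
pose k := gh * (rhos p - rhow p) / (2 * rhow p).
have gh0 : 0 < gh by rewrite mulr_gt0.
have k0 : 0 < k by rewrite !(mulr_gt0, invr_gt0) // subr_gt0.
have ubW : ub W = 0 by rewrite /ub uW aW addr0.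
have AE : transport p W = rows_mx 5 5
  [:: [:: 0; 1; 0; 0; 0]; [:: gh; 0; 0; k; gh]; [:: 0; 0; 0; k; 0];
      [:: 0; 0; 0; 0; 0]; [:: 0; 0; 0; 0; 0]].
  rewrite /transport /delta_h /delta_c /delta_q /rho uW aW cW ubW.
  by rewrite sgr0 !(mulr0, mul0r, oppr0, addr0, subr0, expr0n).
(* w balances the weight - k * gh of the removed water against the pressure
   gh * k of the added sediment in the mean momentum equation; the moment
   equation feels the sediment only. *)
pose w : 'cV[R]_5 := \col_i nth 0 [:: - k; 0; 0; gh; 0] i.
have Aw : transport p W *m w = \col_i nth 0 [:: 0; 0; k * gh; 0; 0] i.
  rewrite AE; apply/matrixP => -[[|[|[|[|[|//]]]]] Hi] j;
    rewrite !mxE !big_ord_recl big_ord0 !mxE /=; ring.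
apply: (@not_yong_II_jordan _ _ _ w).
  rewrite Aw AE; apply/matrixP => -[[|[|[|[|[|//]]]]] Hi] j;
    rewrite !mxE !big_ord_recl big_ord0 !mxE /=; ring.
apply/eqP => /matrixP /(_ (inord 2) 0); rewrite Aw !mxE inordK //=.
by apply/eqP; rewrite mulf_neq0 ?gt_eqF.
Qed.

Theorem theorem2 (R : realType) (p : params R) (hp : valid_params p)
    (W : 'rV[R]_5) (hW : water_at_rest W) :
  [/\ yong_I (source_jacobian p W),
      ~ yong_II (transport p W) &
      ~ yong_III (transport p W) (source_jacobian p W)].
Proof.
have nII := not_yong_II_rest hp hW.
split=> //; last by move=> /yong_III_II.
have h_gt0 : 0 < height W by case: hW => -[].
have [[_ _ nu_gt0 _] [omega0_gt0 Sb_gt0 _ _] _ _ _] := hp.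
rewrite source_jacobian_rest //; apply: yong_I_rest_jacobian.
- by rewrite gt_eqF // divr_gt0 ?mulr_gt0 ?exprn_gt0.
- by rewrite gt_eqF // divr_gt0 ?mulr_gt0.
Qed.
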